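(* Let $G$ be a finite group of nilpotency class two (a finite step-2 nilpotent group). Then the automata group $\mathcal G(\mathcal C)$ generated by the Cayley machine $\mathcal C=\mathcal C(G)$ of $G$ is a cross-wired lamplighter group.
   Context: Let $G$ be a finite group. The Cayley machine $\mathcal C=\mathcal C(G)$ is the automaton with state set $G$ and alphabet $G$ in which, at state $g$ on input $a\in G$, the machine goes to state $ga$ and outputs $ga$. Each state $g\in G$ thus defines a map $\mathcal C_g$ on the set $G^\omega$ of right infinite words over $G$, namely $$\mathcal C_g(a_1a_2a_3\cdots)=(ga_1)(ga_1a_2)(ga_1a_2a_3)\cdots,$$ and $\mathcal C_g$ is a bijection. The automata group $\mathcal G(\mathcal C)$ generated by the Cayley machine is the group of bijections of $G^\omega$ (under composition, $(\alpha\beta)(w)=\alpha(\beta(w))$) generated by $\{\mathcal C_g : g\in G\}$. A cross-wired lamplighter group is a (discrete) group isomorphic to a cocompact lattice (discrete cocompact subgroup) in the isometry group of some Diestel-Leader graph. Here, for integers $m,n\ge 2$, the Diestel-Leader graph $DL(m,n)$ is defined as follows: let $T_{m+1}$ and $T_{n+1}$ be the regular trees of degrees $m+1$ and $n+1$, each equipped with a Busemann (height) function $b$, resp. $b'$, with values in $\mathbb Z$ on vertices, based at a chosen end of the tree; the vertices of $DL(m,n)$ are the pairs $(v,w)$ of vertices $v\in T_{m+1}$, $w\in T_{n+1}$ with $b(v)+b'(w)=0$, and $(v,w)$, $(v',w')$ are joined by an edge iff $v,v'$ are adjacent in $T_{m+1}$ and $w,w'$ are adjacent in $T_{n+1}$.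 Its isometry group carries the topology of pointwise convergence, making it a locally compact group. *)

(* Defs.v *)
From HB Require Import structures.
From mathcomp Require Import all_boot all_order all_algebra all_fingroup.
From mathcomp Require Import all_solvable.
From mathcomp Require Import boolp classical_sets functions cardinality.
From mathcomp Require Import topology.

Set Implicit Arguments.
Unset Strict Implicit.
Unset Printing Implicit Defensive.

Local Open Scope classical_set_scope.
Local Open Scope group_scope.

Record bijection (T : Type) := Bijection {
  bij_fun :> T -> T;
  bij_inv : T -> T;
  bij_funK : cancel bij_fun bij_inv;
  bij_invK : cancel bij_inv bij_fun
}.

HB.instance Definition _ (T : Type) := gen_eqMixin (bijection T).
HB.instance Definition _ (T : Type) := gen_choiceMixin (bijection T).

Section BijectionGroup.
Context {T : Type}.
Implicit Types f g h : bijection T.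

Lemma bijection_ext f g : f =1 g -> f = g.
Proof.
case: f g => [f f' fK f'K] [g g' gK g'K] /= /funext fg; subst g.
have e : f' = g' by apply: funext => x; rewrite -[x in LHS]g'K fK.
subst g'; congr Bijection; exact: Prop_irrelevance.
Qed.

Definition bij_one : bijection T := @Bijection T id id (frefl _) (frefl _).

Definition bij_mul f g : bijection T :=
  Bijection (can_comp (bij_funK f) (bij_funK g))
            (can_comp (bij_invK g) (bij_invK f)).

Definition bij_opp f : bijection T := Bijection (bij_invK f) (bij_funK f).

Lemma bij_mulA : associative bij_mul.
Proof. by move=> f g h; apply: bijection_ext. Qed.

Lemma bij_mul1 : left_id bij_one bij_mul.
Proof. by move=> f; apply: bijection_ext. Qed.

Lemma bij_1mul : right_id bij_one bij_mul.
Proof. by move=> f; apply: bijection_ext. Qed.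

Lemma bij_mulV : left_inverse bij_one bij_opp bij_mul.
Proof. by move=> f; apply: bijection_ext => x /=; rewrite bij_funK. Qed.

Lemma bij_Vmul : right_inverse bij_one bij_opp bij_mul.
Proof. by move=> f; apply: bijection_ext => x /=; rewrite bij_invK. Qed.

HB.instance Definition _ := isGroup.Build (bijection T)
  bij_mulA bij_mul1 bij_1mul bij_mulV bij_Vmul.

End BijectionGroup.

Definition subgroup_type (G : groupType) (S : groupClosed G) : Type :=
  {x : G | x \in S}.

Section SubgroupType.
Variables (G : groupType) (S : groupClosed G).

HB.instance Definition _ := SubChoice.on (subgroup_type S).

Lemma subgroup_type_closed : group_closed S.
Proof. by split=> [|x y Sx Sy]; [exact: gpred1 | exact: gpredF]. Qed.

HB.instance Definition _ := SubChoice_isSubGroup.Build G _ (subgroup_type S)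
  subgroup_type_closed.
End SubgroupType.

Definition generated (G : groupType) (A : set G) : {pred G} :=
  [pred x | x \in smallest (fun H : set G => group_closed [in H]) A].

Section Generated.
Variables (G : groupType) (A : set G).

Lemma generated_mul : mulg_closed (generated A).
Proof.
move=> x y; rewrite !inE => Ax Ay H [clH AH].
have /(_ x y) := group_closedM clH; rewrite !inE; apply.
  by apply: Ax.
by apply: Ay.
Qed.

Lemma generated_one : 1 \in generated A.
Proof. by rewrite !inE => H [[H1 _] _]; move: H1; rewrite !inE. Qed.

Lemma generated_inv : invg_closed (generated A).
Proof.
move=> x; rewrite !inE => Ax H [clH AH].
by have /(_ x) := group_closedV clH; rewrite !inE; apply; apply: Ax.
Qed.

HB.instance Definition _ := isMulClosed.Build G (generated A) generated_mul.
HB.instance Definition _ := isMul1Closed.Build G (generated A) generated_one.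
HB.instance Definition _ := isInvClosed.Build G (generated A) generated_inv.
End Generated.

Definition isomorphic (G H : groupType) : Prop :=
  exists phi : {multiplicative G -> H}, bijective phi.

(* Automata with output (Mealy machines) with state set Q and alphabet A.     *)
Record automaton (Q A : Type) := Automaton {
  next : Q -> A -> Q;
  output : Q -> A -> A
}.

(* Right infinite words a_1 a_2 a_3 ... are functions on nat, with a_n the    *)
(* value at n.-1.                                                             *)
Section AutomatonAction.
Variables (Q A : Type) (M : automaton Q A).

Fixpoint state_after (q : Q) (w : nat -> A) (n : nat) : Q :=
  if n is n'.+1 then next M (state_after q w n') (w n') else q.

Definition automaton_map (q : Q) (w : nat -> A) : nat -> A :=
  fun n => output M (state_after q w n) (w n).
End AutomatonAction.

Definition cayley_machine (gT : finGroupType) : automaton gT gT :=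
  Automaton (fun g a => g * a) (fun g a => g * a).

Section CayleyMachine.
Variable gT : finGroupType.
Implicit Types (g : gT) (w : nat -> gT).

Definition cayley_map_inv g w : nat -> gT :=
  fun n => (if n is n'.+1 then w n' else g)^-1 * w n.

Lemma cayley_map_state g w n :
  state_after (cayley_machine gT) g w n.+1
  = automaton_map (cayley_machine gT) g w n.
Proof. by []. Qed.

Lemma cayley_mapK g :
  cancel (automaton_map (cayley_machine gT) g) (cayley_map_inv g).
Proof.
move=> w; apply: funext => -[|n]; rewrite /cayley_map_inv.
  by rewrite /automaton_map /= mulKg.
by rewrite -cayley_map_state /automaton_map [output _]/= mulKg.
Qed.

Lemma cayley_map_invK g :
  cancel (cayley_map_inv g) (automaton_map (cayley_machine gT) g).
Proof.
move=> w; apply: funext; elim=> [|n IHn].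
  by rewrite /automaton_map /= mulKVg.
by rewrite {1}/automaton_map cayley_map_state IHn /= mulKVg.
Qed.

Definition cayley_bijection g : bijection (nat -> gT) :=
  Bijection (cayley_mapK g) (cayley_map_invK g).

Definition cayley_automata_group : groupType :=
  subgroup_type (generated (range cayley_bijection)).
End CayleyMachine.

(* A graph is given by its vertex type and its adjacency relation e.          *)
Section Graphs.
Variables (V : choiceType) (e : rel V).

Definition walk (x y : V) (n : nat) : Prop :=
  exists p : seq V, [/\ path e x p, last x p = y & size p = n].

(* The graph metric, as a relation: it is infinite between distinct connected *)
(* components.                                                                *)
Definition distance (x y : V) (n : nat) : Prop :=
  walk x y n /\ forall m, walk x y m -> (n <= m)%N.

Definition is_tree : Prop :=
  [/\ symmetric e, irreflexive e,
      forall x y, exists n, walk x y n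
    & forall c : seq V, ucycle e c -> (size c <= 2)%N].

Definition regular (d : nat) : Prop := forall x : V, ([set y | e x y] #= `I_d)%card.

Definition geodesic_ray (r : nat -> V) : Prop :=
  forall i j, (i <= j)%N -> distance (r i) (r j) (j - i).

(* b(v) = lim_k (d(v, r_k) - k), an eventually constant sequence in a tree.   *)
Definition busemann (r : nat -> V) (b : V -> int) : Prop :=
  forall v, exists N, forall k, (N <= k)%N ->
    exists2 n, distance v (r k) n & (b v = n%:Z - k%:Z)%R.

Definition isometry (f : V -> V) : Prop :=
  forall x y n, distance (f x) (f y) n <-> distance x y n.

Definition isometries : {pred bijection V} :=
  [pred f : bijection V | `[< isometry f >]].

Lemma isometries_mul : mulg_closed isometries.
Proof.
move=> f g /asboolP hf /asboolP hg; apply/asboolP => x y n /=.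
by split=> [/hf/hg|/hg/hf].
Qed.

Lemma isometries_one : 1 \in isometries.
Proof. exact/asboolP. Qed.

Lemma isometries_inv : invg_closed isometries.
Proof.
move=> f /asboolP hf; apply/asboolP => x y n.
by rewrite -[in X in _ <-> X](bij_invK f x) -[in X in _ <-> X](bij_invK f y) hf.
Qed.

HB.instance Definition _ :=
  isMulClosed.Build (bijection V) isometries isometries_mul.
HB.instance Definition _ :=
  isMul1Closed.Build (bijection V) isometries isometries_one.
HB.instance Definition _ :=
  isInvClosed.Build (bijection V) isometries isometries_inv.

Definition isometry_group : Type := subgroup_type isometries.

Definition isometry_fun (f : isometry_group) : {ptws V -> discrete_topology V} :=
  bij_fun (val f).

HB.instance Definition _ := Group.on isometry_group.
HB.instance Definition _ :=
  Topological.copy isometry_group (initial_topology isometry_fun).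
End Graphs.

Section Cosets.
Variables (G : groupType) (S : groupClosed G).

Definition left_coset_rel : rel G := [rel x y | x^-1 * y \in S].

Lemma left_coset_refl : reflexive left_coset_rel.
Proof. by move=> x; rewrite /left_coset_rel /= mulVg gpred1. Qed.

Lemma left_coset_sym : symmetric left_coset_rel.
Proof. by move=> x y; rewrite /left_coset_rel /= -gpredV invgM invgK. Qed.

Lemma left_coset_trans : transitive left_coset_rel.
Proof.
by move=> y x z /= xy yz; have := gpredM _ _ xy yz; rewrite -mulgA mulVKg.
Qed.

Canonical left_coset_equiv :=
  EquivRel left_coset_rel left_coset_refl left_coset_sym left_coset_trans.

Definition left_cosets := {eq_quot left_coset_equiv}%qT.
End Cosets.

Section Lattices.
Variables (V : choiceType) (e : rel V).
Implicit Types S : groupClosed (isometry_group e).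

Definition discrete_subgroup S : Prop := [set` S] `<=` isolated [set` S].

Definition cocompact_subgroup S : Prop :=
  compact [set: quotient_topology (left_cosets S)].

Definition cocompact_lattice S : Prop :=
  discrete_subgroup S /\ cocompact_subgroup S.
End Lattices.

(* A d-regular tree with a chosen end, the class of tree_ray, and a Busemann  *)
(* function based at it. Busemann functions of an end differ by an additive   *)
(* integer constant, and all of them arise by changing the representing ray.  *)
Record busemann_tree (d : nat) := BusemannTree {
  tree_vertex : choiceType;
  tree_adj : rel tree_vertex;
  tree_ray : nat -> tree_vertex;
  tree_height : tree_vertex -> int;
  _ : is_tree tree_adj;
  _ : regular tree_adj d;
  _ : geodesic_ray tree_adj tree_ray;
  _ : busemann tree_adj tree_ray tree_height
}.

Section DiestelLeader.
Variables (m n : nat) (T : busemann_tree m.+1) (T' : busemann_tree n.+1).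

Definition DL_vertex : choiceType :=
  {p : tree_vertex T * tree_vertex T'
     | (tree_height p.1 + tree_height p.2 == 0)%R}.

Definition DL_adj : rel DL_vertex := [rel p q |
  tree_adj (val p).1 (val q).1 && tree_adj (val p).2 (val q).2].
End DiestelLeader.

Definition cross_wired_lamplighter (H : groupType) : Prop :=
  exists (m n : nat) (T : busemann_tree m.+1) (T' : busemann_tree n.+1)
         (S : groupClosed (isometry_group (@DL_adj m n T T'))),
    [/\ (2 <= m)%N, (2 <= n)%N, cocompact_lattice S
      & isomorphic H (subgroup_type S)].

(* Main.v *)
From HB Require Import structures.
From mathcomp Require Import all_boot all_order all_algebra all_fingroup.
From mathcomp Require Import all_solvable.
From mathcomp Require Import mathcomp_extra boolp classical_sets functions.
From mathcomp Require Import cardinality filter generic_quotient finmap.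
From mathcomp Require Import topology zify.
Require Import Defs.

(** Write Gamma for the automata group, x for its generator C_1, which sends a
word to the sequence of its prefix products, and lamp g = x^-1 C_g, which
multiplies the first letter by g on the left. Then Gamma is generated by x and
the copy G_0 = lamp(G) of G; put G_k = x^k G_0 x^-k. The proof exhibits Gamma
as a group acting simply transitively on the vertices of DL(q, q), with
q = #|G|.

The action comes from two subgroups: B, generated by the G_k with k <= 0, whose
elements change only finitely many letters, and A, generated by the G_k with
k >= 1. Conjugation by x shrinks A and conjugation by x^-1 shrinks B, each time
to a subgroup of index q, so the left cosets of A and those of B form two
(q+1)-regular trees, in which the parent of a A is a x^-1 A and the parent of
b B is b x B. If A and B meet trivially and the kernel of the height
homomorphism Gamma -> Z, x |-> 1, lamp g |-> 0, is the product set A B, then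
a |-> (a A, a B) is a bijection from Gamma onto the vertices of the
Diestel-Leader graph of the two trees. It carries the adjacency relation to a
left-invariant relation on Gamma, which contains all pairs (a, a C_g), so that
DL(q, q) becomes a connected locally finite Cayley graph of Gamma. This
is lamplighter_criterion. A group acting by left translations on such a Cayley
graph is discrete in the isometry group because its action is free, and it is
cocompact because the action is transitive and vertex stabilizers in the whole
isometry group are compact (cayley_graph_lattice).

Class two is what makes A and B small enough. Let T_N be the product set
G_0 G_(-1) ... G_(1-N); it acts on the first N letters. That T_N is a subgroup
reduces to the claim that G_0 normalizes G_(-1) ... G_(-N), and after
conjugation by x to the claim that for f in T_N the commutator of f with the
multiplication of all letters by a constant g lies in T_N. Every element of T_N
is affine: up to central factors that do not depend on the argument, it commutes
with left translations of words (class two enters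
in affine_lamp and affine_conj_prod).
  Hence that commutator is a translation by a central word supported on
the first N letters, and every such translation in Gamma belongs to T_N
(central_translation_tower). Therefore B is the union of the T_N, A is the
union of the x^n T_n x^-n, and the factorization of the kernel comes from
splitting T_(m+k) as T_m followed by x^-m T_k x^m. Finally A meets B trivially
because conjugation by x^-1 moves the last letter that an element of B changes
one step to the right (fixes_descend). *)

Set Implicit Arguments.
Unset Strict Implicit.
Unset Printing Implicit Defensive.

Local Open Scope classical_set_scope.
Local Open Scope quotient_scope.
Local Open Scope group_scope.

(** * Regular trees from a parent map *)

Section Walks.
Variables (V : choiceType) (e : rel V).

Lemma walk0 x : walk e x x 0.
Proof. by exists [::]. Qed.

Lemma walkS x y z n : e x y -> walk e y z n -> walk e x z n.+1.
Proof.
by move=> exy [p [pp lp sp]]; exists (y :: p); split; rewrite /= ?exy ?sp.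
Qed.

Lemma walkD x y z m n : walk e x y m -> walk e y z n -> walk e x z (m + n).
Proof.
move=> [p [pp lp sp]] [q [pq lq sq]]; exists (p ++ q).
by rewrite cat_path last_cat lp pp pq lq size_cat sp sq.
Qed.

Lemma walk_sym : symmetric e -> forall x y n, walk e x y n -> walk e y x n.
Proof.
move=> sym x y n [p [pp lp sp]]; exists (rev (belast x p)); split.
- rewrite -lp rev_path; apply: sub_path pp => u v; by rewrite /= sym.
- by rewrite -lp; case: (p) => //= z p'; rewrite rev_cons last_rcons.
- by rewrite size_rev size_belast.
Qed.

End Walks.

(** A regular tree with a chosen end is the same thing as a parent map that
lowers a height by one, has exactly q preimages at each vertex, and makes any
two vertices of equal height meet after finitely many steps: the end is reached
by iterating the map, and the height is its Busemann function. *)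
Section ParentTree.
Variables (V : choiceType) (parent : V -> V) (height : V -> int) (q : nat).
Hypothesis height_parent : forall v, height (parent v) = (height v - 1)%R.
Hypothesis children :
  forall v, exists2 c : 'I_q -> V, injective c
    & forall u, (parent u = v) <-> (exists i, u = c i).
Hypothesis common_ancestor :
  forall u v, height u = height v ->
    exists k, iter k parent u = iter k parent v.
Variable root : V.
Hypothesis height_root : height root = 0%R.

Definition parent_adj : rel V := [rel u v | (parent u == v) || (parent v == u)].
Definition ancestor_ray k := iter k parent root.

Local Notation e := parent_adj.

Lemma parent_adj_sym : symmetric e.
Proof. by move=> u v; rewrite /parent_adj /= orbC. Qed.

Lemma height_iter k v : height (iter k parent v) = (height v - k%:Z)%R.
Proof. by elim: k => [|k IH] /=; rewrite ?height_parent ?IH; lia. Qed.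

(** This bound makes the walk from a vertex up to one of its ancestors a
shortest one, hence gives all the distances used below. *)
Lemma walk_height n u v : walk e u v n -> (height u - height v <= n%:Z)%R.
Proof.
case=> p [pp <- <-]; elim: p u pp => [|w p IH] u /=; first lia.
case/andP=> uw /IH le; have: (height u <= height w + 1)%R; last lia.
by case/orP: uw => /eqP <-; rewrite height_parent; lia.
Qed.

Lemma walk_ancestor k v : walk e v (iter k parent v) k.
Proof.
elim: k => [|k IH]; first exact: walk0.
rewrite -[X in walk _ _ _ X]addn1; apply: walkD IH _; apply: walkS (walk0 _ _).
by rewrite /parent_adj /= eqxx.
Qed.

Lemma distance_ancestor k v : distance e v (iter k parent v) k.
Proof.
split; first exact: walk_ancestor.
by move=> m /walk_height; rewrite height_iter; lia.
Qed.

Lemma common_ancestor_levels u v :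
  exists i j, iter i parent u = iter j parent v.
Proof.
have le a b : (height a <= height b)%R ->
    exists i j, iter i parent a = iter j parent b.
  move=> leab; have [d dE] : exists d : nat, (height b - d%:Z)%R = height a.
    by exists `|(height b - height a)%R|%N; lia.
  have [k kE] := @common_ancestor a (iter d parent b) ltac:(by rewrite
    height_iter dE).
  by exists k, (k + d)%N; rewrite iterD.
case/orP: (Order.TotalTheory.le_total (height u) (height v)) => /le //.
by move=> [i [j ij]]; exists j, i.
Qed.

Lemma parent_connected u v : exists n, walk e u v n.
Proof.
have [i [j ij]] := common_ancestor_levels u v.
exists (i + j)%N; apply: walkD (walk_ancestor i u) _.
rewrite ij; exact/(walk_sym parent_adj_sym)/walk_ancestor.
Qed.

Lemma seq_argmax (f : V -> int) x s :
  exists2 y, y \in x :: s & forall z, z \in x :: s -> (f z <= f y)%R.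
Proof.
elim: s x => [|a s IH] x; first by exists x;
  rewrite ?mem_head // => z /[!inE] /eqP->.
have [y ys ymax] := IH a.
case: (Order.TotalTheory.leP (f x) (f y)) => xy.
  by exists y => [|z]; rewrite inE ?ys ?orbT // => /orP[/eqP->|/ymax].
exists x => [|z]; rewrite ?mem_head // inE => /orP[/eqP->|/ymax] //; lia.
Qed.

(** Both neighbours in a cycle of a vertex of maximal height must be its
parent, hence coincide. *)
Lemma parent_acyclic c : ucycle e c -> (size c <= 2)%N.
Proof.
case: c => // x0 c0; have [x xc xmax] := seq_argmax height x0 c0.
move: (x0 :: c0) xc xmax => c /rot_to[i s rotc] xmax /andP[cyc uc].
have up y : e x y -> y \in c -> y = parent x.
  move=> /orP[/eqP->//|/eqP yx] /xmax; rewrite -yx height_parent; lia.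
rewrite -(size_rot i c) rotc; move: cyc uc;
  rewrite -(rot_cycle i) -(rot_uniq i) rotc.
have mem z : z \in s -> z \in c by move=> zs;
  rewrite -(mem_rot i) rotc inE zs orbT.
case: s mem {rotc} => [|y s] //= mem /andP[xy];
  rewrite rcons_path => /andP[_ lx].
case/and3P=> _ ys _; have yE := up y xy (mem _ (mem_head _ _)).
have := up (last y s) _ (mem _ (mem_last _ _)); rewrite -yE.
rewrite parent_adj_sym => /(_ lx) ly.
by case: s ly ys {mem lx} => [|z s] //= <-; rewrite mem_last.
Qed.

Lemma parent_is_tree : is_tree e.
Proof.
split; [exact: parent_adj_sym| |exact: parent_connected|exact: parent_acyclic].
move=> x; apply/negP => /orP[] /eqP /(congr1 height);
  by rewrite height_parent; lia.
Qed.

Lemma parent_regular : regular e q.+1.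
Proof.
move=> x; have [c c_inj cP] := children x.
have -> : [set y | e x y] = [set` parent x :: codom c].
  apply/seteqP; split=> y /=; rewrite inE.
    case/orP=> [/eqP<-|/eqP/cP[i ->]]; first by rewrite eqxx.
    by rewrite codom_f orbT.
  case/orP=> [/eqP->|/codomP[i ->]]; first by rewrite /parent_adj /= eqxx.
  by apply/orP; right; apply/eqP/cP; exists i.
have u : uniq (parent x :: codom c).
  rewrite /= map_inj_uniq ?enum_uniq // andbT.
  apply/negP => /codomP[i pE]; have /cP : exists i, parent x = c i by exists i.
  by move/(congr1 height); rewrite !height_parent; lia.
rewrite (_ : [set` _] = [set` [fset v in parent x :: codom c]%fset]).
  by apply/card_eq_fsetP; rewrite card_fseq undup_id //= size_codom card_ord.
by apply/seteqP; split=> y /=; rewrite in_fset.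
Qed.

Lemma parent_geodesic_ray : geodesic_ray e ancestor_ray.
Proof.
move=> i j ij; have -> : ancestor_ray j = iter (j - i) parent (ancestor_ray i).
  by rewrite -iterD subnK.
exact: distance_ancestor.
Qed.

Lemma parent_busemann : busemann e ancestor_ray height.
Proof.
move=> v; have [i [j ij]] := common_ancestor_levels v root.
exists j => k jk; exists (i + (k - j))%N.
  have -> : ancestor_ray k = iter (i + (k - j)) parent v.
    by rewrite addnC iterD ij -iterD subnK.
  exact: distance_ancestor.
have := congr1 height ij; rewrite !height_iter height_root; lia.
Qed.

Definition parent_tree : busemann_tree q.+1 :=
  BusemannTree parent_is_tree parent_regular parent_geodesic_ray
    parent_busemann.

End ParentTree.

(** * Groups as lattices in the isometry group of a Cayley graph *)

(** Along an ultrafilter, a function that takes finitely many values is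
eventually constant; this is the source of pointwise limits of isometries. *)
Lemma ultra_finite_const (T : Type) (U : choiceType) (F : set_system T)
    (D : set U) (h : T -> U) :
  UltraFilter F -> finite_set D -> F [set t | D (h t)] ->
  exists w, F [set t | h t = w].
Proof.
move=> FU /finite_seqP[s ->]; elim: s => [|a s IH] FD.
  by have /filter_ex[t] : F set0 by apply: filterS FD => t /=; rewrite inE.
case: (in_ultra_setVsetC [set t | h t = a] FU) => Fa; first by exists a.
apply: IH; apply: filterS (filterI Fa FD) => t [/= /eqP ta].
by rewrite inE (negPf ta).
Qed.

Section GraphIsometries.
Variables (V : choiceType) (e : rel V).

Lemma walk_distance x y n : walk e x y n -> exists m, distance e x y m.
Proof.
move=> w; have ex : exists n, `[<walk e x y n>] by exists n; apply/asboolP.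
exists (ex_minn ex); case: ex_minnP => m /asboolP wm min.
by split=> // k /asboolP /min.
Qed.

Lemma walk_map f x y n : {homo f : u v / e u v} ->
  walk e x y n -> walk e (f x) (f y) n.
Proof.
move=> fe [p [pp <- <-]]; exists (map f p).
by rewrite last_map size_map path_map; split=> //; exact: sub_path pp.
Qed.

Lemma automorphism_isometry (f : bijection V) :
  {mono f : u v / e u v} -> isometry e f.
Proof.
move=> fe; have wE x y n : walk e (f x) (f y) n <-> walk e x y n.
  split; last by apply: walk_map => u v; rewrite fe.
  rewrite -[in X in _ -> X](bij_funK f x) -[in X in _ -> X](bij_funK f y).
  by apply: walk_map => u v; rewrite -[e (bij_inv _ _) _]fe !bij_invK.
by move=> x y n; split=> -[/wE w min]; split=> // m /wE /min.
Qed.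

Lemma isometryP (f : isometry_group e) : isometry e (val f).
Proof. by have /asboolP := valP f. Qed.

Lemma nbhs_isometry_at (f : isometry_group e) v :
  nbhs f [set g : isometry_group e | val g v = val f v].
Proof.
have c : continuous (fun g : isometry_group e =>
    (isometry_fun g v : discrete_topology V)).
  move=> g; apply: (@continuous_comp _ _ _ (@isometry_fun _ e)
    (@proj V (fun=> discrete_topology V) v)).
    exact: initial_continuous.
  exact: proj_continuous.
have := c f [set val f v]; apply.
by rewrite nbhs_principalE; apply/principal_filterP.
Qed.

(** The topology comes from the product of discrete spaces, so it is enough to
become eventually constant at every vertex. *)
Lemma cvg_isometry (F : set_system (isometry_group e)) (f : isometry_group e) :
  Filter F -> (forall v, F [set g : isometry_group e | val g v = val f v]) ->
    F --> f.
Proof.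
move=> FF Fv A /=; rewrite (@nbhsE (initial_topology (@isometry_fun _ e))).
case=> [B [[C oC CB]] Bf BA]; apply: filterS BA _.
have : (@isometry_fun _ e) @ F --> (isometry_fun f : {ptws V ->
  discrete_topology V}).
  apply/cvg_sup => v D; rewrite nbhsE => -[_ [[C' oC' <-] C'f] sD].
  apply: (@filterS _ F FF _ _ _ (Fv v)) => g /= gv.
  by apply: sD; rewrite /= /isometry_fun gv.
rewrite -CB; apply.
by rewrite nbhsE; exists C => //; split=> //; move: Bf; rewrite -CB.
Qed.

Section Stabilizer.
Hypothesis connected : forall x y, exists n, walk e x y n.
Hypothesis locally_finite : forall x, finite_set [set y | e x y].

Lemma finite_sphere x n : finite_set [set y | walk e x y n].
Proof.
elim: n x => [|n IH] x.
  apply: (@sub_finite_set _ _ [set x]); last exact: finite_set1.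
  by move=> y [p [_ <- /size0nil ->]].
apply: (@sub_finite_set _ _
  (\bigcup_(z in [set z | e x z]) [set y | walk e z y n])); last first.
  by apply: bigcup_finite => // z _.
move=> y [[|z p] []] //= /andP[xz pp] ly [sp].
by exists z => //; exists p.
Qed.

Lemma finite_orbit_stabilizer o v :
  finite_set [set w | exists2 f : isometry_group e, val f o = o & val f v = w].
Proof.
have [n /walk_distance[m d]] := connected o v.
apply: sub_finite_set (finite_sphere o m) => _ [f fo <-] /=.
by rewrite -[in walk _ o]fo; case: ((isometryP f o v m).2 d).
Qed.

(** The stabilizer of o maps each vertex into a sphere around o, which is
finite. So an ultrafilter of isometries fixing o has a pointwise limit k; the
inverses have a pointwise limit k' as well, and the two limits are mutually
inverse because each identity to check involves finitely many vertices, at which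
the limits agree with a member of the filter. The second limit is what gives
surjectivity of k. *)
Lemma compact_stabilizer o : compact [set f : isometry_group e | val f o = o].
Proof.
rewrite compact_ultra => F FU FK.
have ex (h : isometry_group e -> isometry_group e) :
    (forall f : isometry_group e, val f o = o -> val (h f) o = o) ->
    exists k : V -> V, forall v, F [set f : isometry_group e | val (h f) v
      = k v].
  move=> ho; have /choice[k kP] : forall v, exists w,
    F [set f : isometry_group e | val (h f) v = w].
    move=> v; apply: ultra_finite_const (finite_orbit_stabilizer o v) _.
    by apply: filterS FK => f /= fo; exists (h f) => //; exact: ho.
  by exists k.
have [k kP] := ex id (fun f => id).
have [k' k'P] : exists k : V -> V, forall v,
  F [set f : isometry_group e | val f^-1 v = k v].
  by apply: ex => f fo; rewrite -[in LHS]fo /= bij_funK.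
have kK : cancel k k'.
  move=> v; have [f [/= fk <-]] := filter_ex (filterI (kP v) (k'P (k v))).
  by rewrite -fk bij_funK.
have k'K : cancel k' k.
  move=> v; have [f [/= fk <-]] := filter_ex (filterI (k'P v) (kP (k' v))).
  by rewrite -fk bij_invK.
have kiso : Bijection kK k'K \in isometries e.
  apply/asboolP => x y n /=.
  by have [f [/= <- <-]] := filter_ex (filterI (kP x) (kP y)); exact: isometryP.
exists (Sub (Bijection kK k'K) kiso); split=> /=.
  by have [f [/= fo <-]] := filter_ex (filterI FK (kP o)).
exact: cvg_isometry.
Qed.

End Stabilizer.
End GraphIsometries.

Section MorphismImage.
Variables (G H : groupType) (f : {multiplicative G -> H}).

Lemma multiplicative1 : f 1 = 1.
Proof. by apply: (mulgI (f 1)); rewrite -gmulfM !mulg1. Qed.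

Lemma multiplicativeV x : f x^-1 = (f x)^-1.
Proof. by apply: (mulgI (f x)); rewrite -gmulfM !mulgV multiplicative1. Qed.

Definition morphism_image : {pred H} := [pred y | `[<exists x, y = f x>]].

Lemma morphism_imageP y : reflect (exists x, y = f x) (y \in morphism_image).
Proof. exact: asboolP. Qed.

Lemma morphism_image_mul : mulg_closed morphism_image.
Proof.
move=> _ _ /morphism_imageP[x ->] /morphism_imageP[y ->].
by apply/morphism_imageP; exists (x * y); rewrite gmulfM.
Qed.

Lemma morphism_image_one : 1 \in morphism_image.
Proof. by apply/morphism_imageP; exists 1; rewrite multiplicative1. Qed.

Lemma morphism_image_inv : invg_closed morphism_image.
Proof.
move=> _ /morphism_imageP[x ->].
by apply/morphism_imageP; exists x^-1; rewrite multiplicativeV.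
Qed.

HB.instance Definition _ := isMulClosed.Build H morphism_image
  morphism_image_mul.
HB.instance Definition _ := isMul1Closed.Build H morphism_image
  morphism_image_one.
HB.instance Definition _ := isInvClosed.Build H morphism_image
  morphism_image_inv.

Definition morphism_corestr (x : G) : subgroup_type morphism_image :=
  Sub (f x) (introT (morphism_imageP _) (ex_intro _ x erefl)).

Lemma morphism_corestr_mul : {morph morphism_corestr : x y / x * y}.
Proof. by move=> x y; apply: val_inj; rewrite /= gmulfM. Qed.

HB.instance Definition _ := isMultiplicative.Build G (subgroup_type
  morphism_image)
  morphism_corestr morphism_corestr_mul.

Lemma injective_morphism_isomorphic :
  injective f -> isomorphic G (subgroup_type morphism_image).
Proof.
move=> f_inj; exists morphism_corestr.
have /choice[g gP] : forall y : subgroup_type morphism_image, exists x,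
  val y = f x.
  by move=> y; apply/morphism_imageP/valP.
exists g => x; first by apply: f_inj; rewrite -gP.
by apply: val_inj; rewrite /= -gP.
Qed.

End MorphismImage.

(** The graph is a Cayley graph of G in the sense that its vertices are labelled
by G so that adjacency is invariant under left translation. *)
Section CayleyGraph.
Variables (G : groupType) (V : choiceType) (e : rel V).
Variables (vertex : G -> V) (elt : V -> G) (S : pred G).
Hypothesis vertexK : cancel vertex elt.
Hypothesis eltK : cancel elt vertex.
Hypothesis adjE : forall x y, e (vertex x) (vertex y) = S (x^-1 * y).
Hypothesis connected : forall x y, exists n, walk e x y n.
Hypothesis locally_finite : forall x, finite_set [set y | e x y].

Definition translation_fun (g : G) (v : V) := vertex (g * elt v).

Lemma translation_funK g : cancel (translation_fun g) (translation_fun g^-1).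
Proof. by move=> v; rewrite /translation_fun vertexK mulKg eltK. Qed.

Lemma translation_funKV g : cancel (translation_fun g^-1) (translation_fun g).
Proof. by move=> v; rewrite /translation_fun vertexK mulKVg eltK. Qed.

Lemma translation_isometry g :
  Bijection (translation_funK g) (translation_funKV g) \in isometries e.
Proof.
apply/asboolP/automorphism_isometry => u v /=.
by rewrite adjE invgM -mulgA mulKg -adjE !eltK.
Qed.

Definition translation g : isometry_group e :=
  Sub (Bijection (translation_funK g) (translation_funKV g))
    (translation_isometry g).

Lemma translation_mul : {morph translation : x y / x * y}.
Proof.
move=> x y; apply: val_inj; apply: bijection_ext => v /=.
by rewrite /translation_fun vertexK mulgA.
Qed.

HB.instance Definition _ :=
  isMultiplicative.Build G (isometry_group e) translation translation_mul.

Lemma translation_vertex g x : val (translation g) (vertex x) = vertex (g * x).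
Proof. by rewrite /= /translation_fun vertexK. Qed.

Lemma translation_inj : injective translation.
Proof.
move=> x y /(congr1 (fun f : isometry_group e => val f (vertex 1))).
by rewrite !translation_vertex !mulg1 => /(can_inj vertexK).
Qed.

(** The isometries with a given value at the base vertex form an open set, which
contains a single translation. *)
Lemma translations_discrete : discrete_subgroup (morphism_image translation).
Proof.
move=> f /= fS; split; first exact/mem_set.
exists [set g : isometry_group e | val g (vertex 1) = val f (vertex 1)].
  exact: nbhs_isometry_at.
case/morphism_imageP: fS => x ->; apply/seteqP;
  split=> [g [gx /morphism_imageP[y gE]]|_ ->].
  rewrite gE; congr translation; apply: (can_inj vertexK).
  by move: gx; rewrite /mkset gE !translation_vertex !mulg1.
by split=> //; apply/morphism_imageP; exists x.
Qed.

(** Translations are transitive on vertices, so every coset of the translation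
group meets the compact stabilizer of the base vertex. *)
Lemma translations_cocompact : cocompact_subgroup (morphism_image translation).
Proof.
rewrite /cocompact_subgroup; set Q := quotient_topology _.
have -> : [set: Q] = (\pi_Q : _ ->
  Q) @` [set f : isometry_group e | val f (vertex 1) = vertex 1].
  apply/seteqP; split=> // q _; rewrite -[q]reprK; move: (repr q) => f.
  pose x := elt (val f^-1 (vertex 1)).
  (* The translation by x takes the base vertex to its preimage under f. *)
  exists (f * translation x).
    change (val f (val (translation x) (vertex 1)) = vertex 1).
    by rewrite translation_vertex mulg1 eltK bij_invK.
  apply/eqmodP; rewrite /= /left_coset_rel /=.
  by rewrite invgM mulgVK gpredV; apply/morphism_imageP; exists x.
apply: (@continuous_compact (isometry_group e)
  (quotient_topology (left_cosets (morphism_image translation)))).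
  exact/continuous_subspaceT/pi_continuous.
exact: compact_stabilizer.
Qed.

Theorem cayley_graph_lattice :
  exists T : groupClosed (isometry_group e),
    cocompact_lattice T /\ isomorphic G (subgroup_type T).
Proof.
pose T : groupClosed (isometry_group e) := morphism_image translation.
exists T; split; last first.
  exact/injective_morphism_isomorphic/translation_inj.
split; [exact: translations_discrete | exact: translations_cocompact].
Qed.

End CayleyGraph.

(** * Subgroups that make a group a lattice in DL(q, q) *)

Section AdditiveCharacter.
Variables (G : groupType) (h : G -> int).
Hypothesis hM : forall x y, h (x * y) = (h x + h y)%R.

Lemma additive1 : h 1 = 0%R.
Proof. by have := hM 1 1; rewrite mulg1; lia. Qed.

Lemma additiveV x : h x^-1 = (- h x)%R.
Proof. by have := hM x x^-1; rewrite mulgV additive1; lia. Qed.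

End AdditiveCharacter.

(** The tree of an ascending chain of subgroups: the ancestors of the coset a C
are the cosets a s^-k C, and a C has as children the a (rep i) C. Any two
cosets of equal height have a common ancestor because the subgroups s^-k C s^k
exhaust the kernel of h. *)
Section CosetTree.
Variables (G : groupType) (C : groupClosed G) (h : G -> int) (s : G) (q : nat).
Variable rep : 'I_q -> G.
Hypothesis hM : forall x y, h (x * y) = (h x + h y)%R.
Hypothesis hs : h s = 1%R.
Hypothesis hC : forall x, x \in C -> h x = 0%R.
Hypothesis conjC : forall x, x \in C -> s * x * s^-1 \in C.
Hypothesis repP : forall x, x * s^-1 \in C <-> exists i, (rep i)^-1 * x \in C.
Hypothesis rep_inj : forall i j, (rep i)^-1 * rep j \in C -> i = j.
Hypothesis absorb : forall x, h x = 0%R -> exists k, s ^+ k * x * s ^- k \in C.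

Definition coset (x : G) : left_cosets C := \pi_(left_cosets C) x.

Lemma cosetP x y : coset x = coset y <-> x^-1 * y \in C.
Proof. by split=> [/eqmodP|xy]; last apply/eqmodP. Qed.

Lemma coset_eqE x y : (coset x == coset y) = (x^-1 * y \in C).
Proof. by apply/eqP/idP => /cosetP. Qed.

Lemma coset_surj (v : left_cosets C) : exists x, v = coset x.
Proof. by exists (repr v); rewrite /coset reprK. Qed.

Definition coset_parent (v : left_cosets C) : left_cosets C := coset (repr v *
  s^-1).

Definition coset_height (v : left_cosets C) : int := h (repr v).

Lemma coset_parentE x : coset_parent (coset x) = coset (x * s^-1).
Proof.
have : coset (repr (coset x)) = coset x by rewrite /coset reprK.
move/cosetP/conjC=> rx; apply/cosetP; move: rx.
by rewrite invgM invgK !mulgA.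
Qed.

Lemma coset_heightE x : coset_height (coset x) = h x.
Proof.
have : coset (repr (coset x)) = coset x by rewrite /coset reprK.
by move/cosetP/hC; rewrite hM (additiveV hM) /coset_height; clear hs; lia.
Qed.

Lemma coset_height_parent v :
  coset_height (coset_parent v) = (coset_height v - 1)%R.
Proof.
have [x ->] := coset_surj v.
by rewrite coset_parentE !coset_heightE hM (additiveV hM) hs.
Qed.

Lemma coset_children v : exists2 c : 'I_q -> left_cosets C, injective c
    & forall u, coset_parent u = v <-> exists i, u = c i.
Proof.
have [x ->] := coset_surj v; exists (fun i => coset (x * rep i)).
  by move=> i j /cosetP; rewrite invgM -mulgA mulKg => /rep_inj.
move=> u; have [y ->] := coset_surj u; rewrite coset_parentE; split.
  move=> /esym/cosetP; rewrite mulgA => /repP[i yi]; exists i.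
  by apply/esym/cosetP; rewrite invgM -mulgA.
case=> i /esym/cosetP; rewrite invgM -mulgA => yi.
by apply/esym/cosetP; rewrite mulgA; apply/repP; exists i.
Qed.

Lemma iter_coset_parent k x :
  iter k coset_parent (coset x) = coset (x * s ^- k).
Proof.
elim: k => [|k IH] /=; first by rewrite expg0 invg1 mulg1.
by rewrite IH coset_parentE expgS invgM mulgA.
Qed.

Lemma coset_common_ancestor u v : coset_height u = coset_height v ->
  exists k, iter k coset_parent u = iter k coset_parent v.
Proof.
have [x ->] := coset_surj u; have [y ->] := coset_surj v.
rewrite !coset_heightE => xy.
have [k kC] := @absorb (x^-1 * y) ltac:(by rewrite hM (additiveV hM) xy; lia).
by exists k; rewrite !iter_coset_parent; apply/cosetP; move: kC;
  rewrite invgM invgK !mulgA.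
Qed.

Lemma coset_height_root : coset_height (coset 1) = 0%R.
Proof. by rewrite coset_heightE (additive1 hM). Qed.

Definition coset_tree : busemann_tree q.+1 :=
  parent_tree coset_height_parent coset_children coset_common_ancestor
    coset_height_root.

Lemma coset_adjE x y : tree_adj (coset x : tree_vertex coset_tree) (coset y) =
  (s * (x^-1 * y) \in C) || (s * (y^-1 * x) \in C).
Proof.
rewrite /= /parent_adj /= !coset_parentE !coset_eqE.
by rewrite !invgM !invgK !mulgA.
Qed.

End CosetTree.

Lemma tree_locally_finite d (T : busemann_tree d) (v : tree_vertex T) :
  finite_set [set w | tree_adj v w].
Proof. by apply/finite_setP; exists d; case: T v => V e r b /= _ reg _ _ v;
  exact: reg. Qed.

(** Here t^-1 A t is the union of the lamp i A, and B is the union of the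
lamp i t^-1 B t, so the two coset trees have the same valency; the first one
climbs along t^-1 and the second one along t. The elements t (lamp i) make up
the intersection of A t and t B, that is, they label the neighbours of the
vertex of 1 that lie below it in the first tree and above it in the second. *)
Section LamplighterCriterion.
Variables (G : groupType) (A B : groupClosed G) (h : G ->
  int) (t : G) (q : nat).
Variable lamp : 'I_q -> G.
Hypothesis hM : forall x y, h (x * y) = (h x + h y)%R.
Hypothesis ht : h t = 1%R.
Hypothesis hA : forall x, x \in A -> h x = 0%R.
Hypothesis hB : forall x, x \in B -> h x = 0%R.
Hypothesis shrinkA : forall x, x \in A -> t * x * t^-1 \in A.
Hypothesis shrinkB : forall x, x \in B -> t^-1 * x * t \in B.
Hypothesis lampA : forall i, t * lamp i * t^-1 \in A.
Hypothesis lampB : forall i, lamp i \in B.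
Hypothesis lamp_inj : injective lamp.
Hypothesis coverA :
  forall x, x \in A -> exists i, (lamp i)^-1 * (t^-1 * x * t) \in A.
Hypothesis coverB :
  forall x, x \in B -> exists i, t * ((lamp i)^-1 * x) * t^-1 \in B.
Hypothesis trivial_meet : forall x, x \in A -> x \in B -> x = 1.
Hypothesis factor : forall x, h x = 0%R ->
  exists a b, [/\ a \in A, b \in B & x = a * b].
Hypothesis absorbA : forall x, x \in B -> exists k, t ^+ k * x * t ^- k \in A.
Hypothesis absorbB : forall x, x \in A -> exists k, t ^- k * x * t ^+ k \in B.
Hypothesis gen : forall D : set G, D 1 -> (forall x y, D x -> D y ->
  D (x * y)) ->
  (forall x, D x -> D x^-1) -> (forall i, D (t * lamp i)) -> forall x, D x.

Lemma lamp_cosetA i j : (lamp i)^-1 * lamp j \in A -> i = j.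
Proof.
move=> ijA; apply: lamp_inj; apply/esym/(mulgI (lamp i)^-1).
by rewrite mulVg; apply: trivial_meet ijA _; rewrite gpredM ?gpredV ?lampB.
Qed.

(** The form in which coset_tree needs the covering of t^-1 A t by the
cosets lamp i A. *)
Lemma upper_repP x :
  x * t^-1 \in A <-> exists i, (t * lamp i)^-1 * x \in A.
Proof.
split=> [/coverA[i iA]|[i]].
  by exists i; move: iA; rewrite invgM -!mulgA mulVg mulg1.
move: (_^-1 * x) (mulKVg (t * lamp i) x) => y <- yA.
have -> : t * lamp i * y * t^-1 = t * lamp i * t^-1 * (t * y * t^-1).
  by rewrite !mulgA mulgVK.
by rewrite gpredM ?lampA ?shrinkA.
Qed.

Lemma shrinkA_iter k x : x \in A -> t ^+ k * x * t ^- k \in A.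
Proof.
move=> xA; elim: k => [|k IH]; first by rewrite expg0 invg1 mulg1 mul1g.
by rewrite expgS invgM !mulgA -(mulgA t) -(mulgA t) shrinkA.
Qed.

Lemma shrinkB_iter k x : x \in B -> t ^- k * x * t ^+ k \in B.
Proof.
move=> xB; elim: k => [|k IH]; first by rewrite expg0 invg1 mulg1 mul1g.
by rewrite expgSr invgM !mulgA -(mulgA t^-1) -(mulgA t^-1) shrinkB.
Qed.

Lemma upper_absorb x : h x = 0%R -> exists k, t ^+ k * x * t ^- k \in A.
Proof.
case/factor=> a [b [aA /absorbA[k bk] ->]]; exists k.
have -> : t ^+ k * (a * b) * t ^- k
  = t ^+ k * a * t ^- k * (t ^+ k * b * t ^- k).
  by rewrite !mulgA mulgVK.
by apply: gpredM => //; exact: shrinkA_iter.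
Qed.

Lemma upper_rep_inj i j : (t * lamp i)^-1 * (t * lamp j) \in A -> i = j.
Proof. by rewrite invgM -mulgA mulKg => /lamp_cosetA. Qed.

Definition upper_tree : busemann_tree q.+1 :=
  coset_tree hM ht hA shrinkA upper_repP upper_rep_inj upper_absorb.

Let hN x := (- h x)%R.

Lemma hNM x y : hN (x * y) = (hN x + hN y)%R.
Proof. by rewrite /hN hM; lia. Qed.

Lemma hNt : hN t^-1 = 1%R.
Proof. by rewrite /hN (additiveV hM) ht. Qed.

Lemma hNB x : x \in B -> hN x = 0%R.
Proof. by rewrite /hN => /hB ->. Qed.

Lemma shrinkB' x : x \in B -> t^-1 * x * t^-1^-1 \in B.
Proof. by rewrite invgK; exact: shrinkB. Qed.

Lemma lower_repP x :
  x * t^-1^-1 \in B <-> exists i, (lamp i * t^-1)^-1 * x \in B.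
Proof.
rewrite invgK; split=> [/coverB[i]|[i]].
  by rewrite !mulgA mulgK => iB; exists i; rewrite invgM invgK.
move: (_^-1 * x) (mulKVg (lamp i * t^-1) x) => y <- yB.
by rewrite -!mulgA gpredM ?lampB // mulgA shrinkB.
Qed.

Lemma lower_rep_inj i j : (lamp i * t^-1)^-1 * (lamp j * t^-1) \in B -> i = j.
Proof.
move=> ijB; apply: lamp_cosetA; set z := _ * _.
suff -> : z = 1 by rewrite gpred1.
have zE : (lamp i * t^-1)^-1 * (lamp j * t^-1) = t * z * t^-1.
  by rewrite /z invgM invgK !mulgA.
have tz1 : t * z * t^-1 = 1.
  apply: trivial_meet; last by rewrite -zE.
  have -> : t * z * t^-1 = (t * lamp i * t^-1)^-1 * (t * lamp j * t^-1).
    by rewrite /z !invgM invgK !mulgA mulgVK.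
  by rewrite gpredM ?gpredV ?lampA.
by apply: (mulgI t); apply: (mulIg t^-1); rewrite mulg1 mulgV.
Qed.

Lemma lower_absorb x : hN x = 0%R -> exists k, t^-1 ^+ k * x * t^-1 ^- k \in B.
Proof.
move=> hx; have {}hx : h x = 0%R by move: hx; rewrite /hN; lia.
case/factor: hx => a [b [/absorbB[k ak] bB ->]]; exists k.
rewrite expVgn invgK.
have -> : t ^- k * (a * b) * t ^+ k
  = t ^- k * a * t ^+ k * (t ^- k * b * t ^+ k).
  by rewrite !mulgA mulgK.
by apply: gpredM => //; exact: shrinkB_iter.
Qed.

Definition lower_tree : busemann_tree q.+1 :=
  coset_tree hNM hNt hNB shrinkB' lower_repP lower_rep_inj lower_absorb.

Definition DL_pair (x : G) : tree_vertex upper_tree * tree_vertex lower_tree :=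
  (coset A x, coset B x).

Lemma DL_pair_height x :
  (tree_height (DL_pair x).1 + tree_height (DL_pair x).2 == 0)%R.
Proof. by rewrite /= !coset_heightE // /hN; [lia|exact: hNM|exact: hNB]. Qed.

Definition DL_of (x : G) : DL_vertex upper_tree lower_tree :=
  Sub (DL_pair x) (DL_pair_height x).

Lemma DL_of_inj : injective DL_of.
Proof.
move=> x y /(congr1 val)[/cosetP xyA /cosetP xyB].
by apply: (mulgI x^-1); rewrite mulVg; apply/esym/trivial_meet.
Qed.

(** Two cosets x A and y B of opposite heights intersect: x^-1 y = a b gives
x a = y b^-1. *)
Lemma DL_of_surj v : exists x, DL_of x = v.
Proof.
case: v => -[u w] /= uw0.
have [x uE] := coset_surj u; have [y wE] := coset_surj w; subst u w.
have xy : h (x^-1 * y) = 0%R.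
  move: uw0; rewrite /= !coset_heightE //; [|exact: hNM|exact: hNB].
  by rewrite /hN hM (additiveV hM); lia.
have [a [b [aA bB ab]]] := factor xy; exists (x * a).
apply: val_inj => /=; rewrite /DL_pair; congr pair; apply/cosetP.
  by rewrite invgM -mulgA mulVg mulg1 gpredV.
by rewrite invgM -mulgA ab mulKg.
Qed.

Definition DL_step : pred G := [pred z |
  ((t * z \in A) || (t * z^-1 \in A)) && ((t^-1 * z \in B) || (t^-1 * z^-1 \in
    B))].

Lemma DL_adjE x y : DL_adj (DL_of x) (DL_of y) = DL_step (x^-1 * y).
Proof.
by apply: (congr2 andb); (etransitivity; first exact: coset_adjE);
  rewrite invgM invgK.
Qed.

Lemma DL_adj_sym : symmetric (@DL_adj _ _ upper_tree lower_tree).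
Proof. by move=> u v; rewrite /DL_adj /=; congr andb;
  exact: parent_adj_sym. Qed.

(** A generator t (lamp i) leads to a child in the first tree and to the parent
in the second. *)
Lemma DL_step_lamp i : DL_step (t * lamp i).
Proof.
apply/andP; split; apply/orP; first right; last by left; rewrite mulKg lampB.
by rewrite -gpredV !invgM !invgK lampA.
Qed.

Lemma DL_connected u v : exists n,
  walk (@DL_adj _ _ upper_tree lower_tree) u v n.
Proof.
have [x <-] := DL_of_surj u; have [y <-] := DL_of_surj v.
rewrite -(mulKVg x y); move: (_^-1 * y) => {u v}z.
pose D : set G := [set z | forall x,
  exists n, walk (@DL_adj _ _ upper_tree lower_tree) (DL_of x) (DL_of (x * z))
    n].
suff Dz : D z by exact: Dz.
apply: (gen (D := D)) => {x y z}[x|y z wy wz x|y wy x|i x].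
- by exists 0; rewrite mulg1; exact: walk0.
- have [m wm] := wy x; have [n wn] := wz (x * y).
  by exists (m + n)%N; rewrite mulgA; exact: walkD wm wn.
- have [n wn] := wy (x * y^-1); exists n; apply: walk_sym;
  first exact: DL_adj_sym.
  by rewrite mulgVK in wn.
by exists 1%N; apply: walkS (walk0 _ _); rewrite DL_adjE mulKg DL_step_lamp.
Qed.

Lemma DL_locally_finite u :
  finite_set [set v | @DL_adj _ _ upper_tree lower_tree u v].
Proof.
apply: (@sub_finite_set _ _ (val @^-1`
  ([set v | tree_adj (val u).1 v] `*` [set w | tree_adj (val u).2 w]))).
  by move=> v /andP.
apply: finite_preimage; first by move=> x y _ _; exact: val_inj.
by apply: finite_setX; exact: tree_locally_finite.
Qed.

Theorem lamplighter_criterion : (2 <= q)%N -> cross_wired_lamplighter G.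
Proof.
move=> q2; have /choice[elt eltK] := DL_of_surj.
have DLK : cancel DL_of elt by move=> x; apply: DL_of_inj; rewrite eltK.
have [T [latT isoT]] := cayley_graph_lattice DLK eltK DL_adjE DL_connected
  DL_locally_finite.
by exists q, q, upper_tree, lower_tree, T.
Qed.

End LamplighterCriterion.

(** * Generated subgroups and conjugation *)

Lemma generated_ind (G : groupType) (X : set G)
    (D : set (subgroup_type (generated X))) :
  D 1 -> (forall x y, D x -> D y -> D (x * y)) -> (forall x, D x -> D x^-1) ->
  (forall x, X (val x) -> D x) -> forall x, D x.
Proof.
move=> D1 DM DV DX x.
pose E : set G := [set y | exists2 z : subgroup_type (generated X),
  val z = y & D z].
suff [z /val_inj <-] : E (val x) by [].
have := valP x; rewrite inE => /set_mem/(_ E); apply; split.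
  split=> [|u v /set_mem[y <- Dy] /set_mem[z <- Dz]]; apply/mem_set;
    first by exists 1.
  by exists (y * z^-1) => //; exact/DM/DV.
move=> y Xy; have yX : y \in generated X by rewrite inE;
  apply/mem_set => H [_ XH]; exact: XH.
by exists (Sub y yX) => //; exact: DX.
Qed.

Lemma conjg_unconj (G : groupType) (a b : G) : (a * b * a^-1) ^ a = b.
Proof. by rewrite conjgE mulgVK mulKg. Qed.

(** * Affine maps of words *)

Definition central (G : groupType) (a : G) := forall b : G, commute a b.

Section Central.
Variable G : groupType.
Implicit Types a b c : G.

Lemma central1 : central (1 : G).
Proof. by move=> b; rewrite /commute mulg1 mul1g. Qed.

Lemma centralM a b : central a -> central b -> central (a * b).
Proof. by move=> ca cb c; rewrite /commute -mulgA (cb c) mulgA (ca c) -mulgA.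
  Qed.

Lemma centralV a : central a -> central a^-1.
Proof. by move=> ca b; apply/esym/commuteV/esym/ca. Qed.

End Central.

Section Words.
Variable gT : finGroupType.
Local Notation word := (nat -> gT).
Implicit Types (u v w z : word) (g : gT).

Definition wmul u w : word := fun n => u n * w n.
Definition winv u : word := fun n => (u n)^-1.
Definition wone : word := fun _ => 1.
Definition wconst g : word := fun _ => g.
Definition wcentral z := forall n, central (z n).

Fixpoint wprod w n : gT := if n is n'.+1 then wprod w n' * w n'.+1 else w 0.
Definition wquot w n : gT := if n is n'.+1 then (w n')^-1 * w n'.+1 else w 0.
Definition wlamp g w n : gT := if n is 0 then g * w 0 else w n.

Lemma wprod_central z : wcentral z -> wcentral (wprod z).
Proof. by move=> cz; elim=> [|n IH] /=; [exact: cz | exact: centralM]. Qed.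

Lemma wprod_mul_central z w : wcentral z ->
  wprod (wmul z w) = wmul (wprod z) (wprod w).
Proof.
move=> cz; apply/funext; elim=> [|n IH] //=; rewrite IH /wmul /=.
by rewrite !mulgA -(mulgA _ _ (z n.+1)) -(cz _ (wprod w n)) !mulgA.
Qed.

(** Equivalently, f commutes with central translations and normalizes the group
of left translations by words, acting trivially on it modulo the central ones.
For nilpotency class two these are the maps w |-> c w beta(w) with beta a
homomorphism to central words that kills central words; the present form
is stable under composition without naming c and beta. *)
Definition affine (f : word -> word) :=
  (forall z w, wcentral z -> f (wmul z w) = wmul z (f w)) /\
  (forall u, exists2 z, wcentral z & forall w,
    f (wmul u w) = wmul z (wmul u (f w))).

Lemma affine_id : affine id.
Proof.
split=> // u; exists wone => [n|w]; first exact: central1.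
by apply/funext => n; rewrite /wmul mul1g.
Qed.

Lemma affine_comp f f' : affine f -> affine f' -> affine (f \o f').
Proof.
move=> [fz fu] [f'z f'u]; split=> [z w cz|u] /=; first by rewrite f'z ?fz.
have [z cz zE] := f'u u; have [z' cz' zE'] := fu u.
exists (wmul z z') => [n|w]; first exact: centralM.
by rewrite zE fz // zE'; apply/funext => n; rewrite /wmul !mulgA.
Qed.

Hypothesis class2 : forall a b : gT, central (a * b * a^-1 * b^-1).

Lemma affine_lamp g : affine (wlamp g).
Proof.
split=> [z w cz|u].
  by apply/funext => -[|n] //=; rewrite /wmul /= !mulgA cz.
exists (fun n => if n is 0 then g * u 0 * g^-1 * (u 0)^-1 else 1) => [[|n]|w].
- exact: class2.
- exact: central1.
by apply/funext => -[|n]; rewrite /wmul /= ?mul1g // !mulgA !mulgVK.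
Qed.

(** The computation behind affine_conj_prod, at one position. The factor κ
measures the failure of prefix products to be multiplicative, and it cancels
the conjugation of u by W in y^-1 u y, which leaves the conjugation of u by
the constant c. *)
Lemma affine_quot_identity (k κ z z' U u W c ζ y y' : gT) :
  central k -> central κ -> central z -> central z' -> central ζ ->
  κ = W * u * W^-1 * u^-1 -> y = ζ * W * c ->
  (k * z * U * y)^-1 * (k * κ * z' * (U * u) * y')
  = z^-1 * z' * (c^-1 * u * c * u^-1) * (u * (y^-1 * y')).
Proof.
move=> ck cκ cz cz' cζ κE yE.
have Wu : W * u = κ * u * W by rewrite κE !mulgVK.
have yu : y * (c^-1 * u * c) = κ * u * y.
  rewrite yE !mulgA mulgK -(mulgA ζ W) Wu !mulgA.
  by rewrite -(mulgA ζ κ u) (cζ (κ * u)).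
pose a := z^-1 * z'; have ca : central a by exact/centralM/cz'/centralV.
apply: (mulgI (k * z * U * y)); rewrite mulKVg.
transitivity (k * z * (a * (U * y)) * ((c^-1 * u * c) * (y^-1 * y')));
  last first.
  by rewrite (ca (U * y)) /a !mulgA mulgVK.
transitivity (k * z * a * U * (y * (c^-1 * u * c)) * y^-1 * y');
  last by rewrite !mulgA.
rewrite yu !mulgA mulgK -(mulgA _ U κ) -(cκ U) /a !mulgA mulgK.
by rewrite -(mulgA k z' κ) -(cκ z') !mulgA.
Qed.

(** Neither prefix products nor their inverse respect multiplication of words,
but the two defects compensate: they are opposite commutators with the prefix
products of the argument, up to a commutator with the constant word f 1. *)
Lemma affine_conj_prod f : affine f -> affine (wquot \o f \o wprod).
Proof.
move=> [fz fu]; split=> [z w cz|u] /=.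
  rewrite wprod_mul_central // fz; last exact: wprod_central.
  apply/funext => -[|n]; rewrite /wmul //=.
  by rewrite invgM !mulgA mulgVK (cz n.+1 _).
have [z cz zE] := fu (wprod u).
pose c := f wone.
(* The last four factors form the commutator of u with the constant c; they
   are what remains of the two defects. *)
exists (fun n => if n is n'.+1 then (z n')^-1 * z n'.+1 * ((c n')^-1 * u n'.+1
  * c n' * (u n'.+1)^-1) else z 0).
  case=> [|n]; first exact: cz.
  apply: centralM; first exact/centralM/cz/centralV.
  rewrite -[X in _ * X * _](invgK (c n)); exact: class2.
move=> w.
pose kappa n := wprod w n * u n.+1 * (wprod w n)^-1 * (u n.+1)^-1.
pose k : word := fix k n := if n is n'.+1 then k n' * kappa n' else 1.
have ck : wcentral k.
  by elim=> [|n IH] /=; [exact: central1 | apply: centralM => //;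
    exact: class2].
have prodE : wprod (wmul u w) = wmul k (wmul (wprod u) (wprod w)).
  apply/funext; elim=> [|n IH]; first by rewrite /wmul /= mul1g.
  rewrite /= IH /wmul /= -(mulgA (k n)) -(mulgA (k n)); congr (k n * _).
  have kappaC : central (kappa n) by exact: class2.
  by rewrite !mulgA (kappaC (wprod u n)) /kappa !mulgA !mulgVK.
have [zw czw zwE] := fu (wprod w).
have yE : f (wprod w) = wmul zw (wmul (wprod w) c).
  by rewrite -zwE; congr f; apply/funext => n; rewrite /wmul mulg1.
rewrite prodE fz // zE; apply/funext => -[|n].
  by rewrite /wmul /= mul1g mulgA.
have := @affine_quot_identity (k n) (kappa n) (z n) (z n.+1) (wprod u n) (u
  n.+1)
  (wprod w n) (c n) (zw n) (f (wprod w) n) (f (wprod w) n.+1).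
rewrite yE /wmul /= !mulgA; apply=> //; exact: class2.
Qed.

Lemma wprodK : cancel wprod wquot.
Proof. by move=> w; apply/funext => -[|n] //=; rewrite mulKg. Qed.

Lemma wquotK : cancel wquot wprod.
Proof. by move=> w; apply/funext; elim=> [|n IH] //=; rewrite IH mulKVg. Qed.

(** * The automata group and its action on words *)

Local Notation Gam := (cayley_automata_group gT).
Implicit Types (a b c f : Gam) (n m N k : nat).

Definition act a : word -> word := bij_fun (val a).

Lemma act_inj a b : act a =1 act b -> a = b.
Proof. by move=> ab; apply/val_inj/bijection_ext. Qed.

Lemma actM a b w : act (a * b) w = act a (act b w).
Proof. by []. Qed.

Lemma act1 w : act 1 w = w.
Proof. by []. Qed.

Lemma actKV a : cancel (act a^-1) (act a).
Proof. by move=> w; rewrite -actM mulgV. Qed.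

Lemma cayley_generator_in g :
  cayley_bijection g \in generated (range (@cayley_bijection gT)).
Proof. by rewrite inE; apply/mem_set => H [_]; apply; exists g. Qed.

Definition cayley_generator g : Gam := Sub (cayley_bijection g)
  (cayley_generator_in g).

(** The state of the identity element, which maps a word to its prefix products;
in the abelian case it is the generator of the lamplighter group that moves the
lighter. *)
Definition shift : Gam := cayley_generator 1.
Local Notation x := shift.
Definition lamp g : Gam := x^-1 * cayley_generator g.

Lemma act_generator g w : act (cayley_generator g) w
  = wmul (wconst g) (wprod w).
Proof.
apply/funext; elim=> [|n IH] //.
have -> : act (cayley_generator g) w n.+1
  = act (cayley_generator g) w n * w n.+1.
  by [].
by rewrite IH /wmul /= mulgA.
Qed.

Lemma act_shift w : act x w = wprod w.
Proof. by rewrite act_generator; apply/funext => n; rewrite /wmul mul1g. Qed.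

Lemma act_shiftV w : act x^-1 w = wquot w.
Proof. by rewrite -[in RHS](actKV x w) act_shift wprodK. Qed.

Lemma act_lamp g w : act (lamp g) w = wlamp g w.
Proof.
rewrite actM act_generator act_shiftV; apply/funext => -[|n] //.
by rewrite /wmul /= invgM !mulgA mulgVK mulVg mul1g.
Qed.

Lemma act_conj f w : act (f ^ x) w = wquot (act f (wprod w)).
Proof. by rewrite conjgE !actM act_shiftV act_shift. Qed.

Lemma lampM g g' : lamp (g * g') = lamp g * lamp g'.
Proof.
by apply: act_inj => w; rewrite actM !act_lamp; apply/funext => -[|n] //=;
  rewrite mulgA.
Qed.

Lemma lamp1 : lamp 1 = 1.
Proof. by rewrite /lamp mulVg. Qed.

Lemma lampV g : lamp g^-1 = (lamp g)^-1.
Proof. by apply: (mulgI (lamp g)); rewrite -lampM !mulgV lamp1. Qed.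

Lemma lamp_inj : injective lamp.
Proof.
move=> g g' /(congr1 (fun f => act f wone 0)).
by rewrite !act_lamp /= !mulg1.
Qed.

Lemma cayley_generatorE g : cayley_generator g = x * lamp g.
Proof. by rewrite /lamp mulKVg. Qed.

Lemma cayley_group_ind (D : set Gam) : D 1 ->
  (forall a b, D a -> D b -> D (a * b)) -> (forall a, D a -> D a^-1) ->
  (forall g, D (x * lamp g)) -> forall a, D a.
Proof.
move=> D1 DM DV Dg; apply: generated_ind => // a [g _ ga].
by have -> : a = x * lamp g by rewrite -cayley_generatorE; apply/val_inj.
Qed.

(** * The finitary and the expanding subgroup *)

Definition fixes_from N a := forall w n, (N <= n)%N -> act a w n = w n.

Lemma fixes0 a : fixes_from 0 a -> a = 1.
Proof. by move=> fa; apply: act_inj => w; apply/funext => n; rewrite fa. Qed.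

Lemma fixes_leq N M a : (N <= M)%N -> fixes_from N a -> fixes_from M a.
Proof. by move=> NM fa w n Mn; apply: fa; exact: leq_trans Mn. Qed.

Lemma fixesM N a b : fixes_from N a -> fixes_from N b -> fixes_from N (a * b).
Proof. by move=> fa fb w n Nn; rewrite actM fa ?fb. Qed.

Lemma fixesV N a : fixes_from N a -> fixes_from N a^-1.
Proof. by move=> fa w n Nn; rewrite -[in RHS](actKV a w) fa. Qed.

Lemma fixes_conj N a : fixes_from N a -> fixes_from N.+1 (a ^ x).
Proof.
move=> fa w [|n] // Nn.
by rewrite act_conj [LHS]/= !fa ?mulKg // leqW.
Qed.

Lemma fixes_lamp g : fixes_from 1 (lamp g).
Proof. by move=> w [|n] //; rewrite act_lamp. Qed.

(** That a ^ x fixes the letters from N+1 on means that a preserves the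
quotients w_n^-1 w_(n+1) for n >= N. As a fixes all letters far out,
  descending from there
shows that it fixes those from N on. *)
Lemma fixes_descend N M a :
  fixes_from N.+1 (a ^ x) -> fixes_from M a -> fixes_from N a.
Proof.
move=> fax fa w n Nn; have [d] : exists d, (M <= n + d)%N by exists M;
  rewrite leq_addl.
elim: d n Nn => [|d IH] n Nn Mnd; first by apply: fa; rewrite addn0 in Mnd.
have := fax (wquot w) n.+1 Nn; rewrite act_conj wquotK /=.
by rewrite (IH n.+1) ?addSnnS ?leqW // => /mulIg/invg_inj.
Qed.

Lemma fixes_meet n M a : fixes_from n (a ^ (x ^+ n)) -> fixes_from M a -> a = 1.
Proof.
elim: n a M => [|n IH] a M fax fa; first by apply: fixes0;
  rewrite expg0 conjg1 in fax.
have fM k : fixes_from (M + k) (a ^ (x ^+ k)).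
  elim: k => [|k IHk]; first by rewrite addn0 expg0 conjg1.
  by rewrite addnS expgSr conjgM; exact: fixes_conj.
apply: IH fa; apply: fixes_descend (fM n); by rewrite -conjgM -expgSr.
Qed.

(** The product set G_0 G_(-1) ... G_(1-N) with G_(-k) = x^-k lamp(G) x^k,
unfolded from the left; class two makes it a subgroup (towerM, towerV). *)
Fixpoint tower N a : Prop :=
  if N is N'.+1 then exists g f, tower N' f /\ a = lamp g * f ^ x else a = 1.

Lemma tower_fixes N a : tower N a -> fixes_from N a.
Proof.
elim: N a => [a -> //|N IH a [g [f [/IH ff ->]]]].
apply: fixesM; last exact: fixes_conj.
exact: fixes_leq (fixes_lamp g).
Qed.

Lemma tower_affine N a : tower N a -> affine (act a).
Proof.
elim: N a => [a ->|N IH a [g [f [/IH ff ->]]]]; first exact: affine_id.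
have -> : act (lamp g * f ^ x) = wlamp g \o (wquot \o act f \o wprod).
  by apply/funext => w; rewrite actM act_lamp act_conj.
exact/affine_comp/affine_conj_prod/ff/affine_lamp.
Qed.

Lemma tower1 N : tower N 1.
Proof. by elim: N => //= N IH; exists 1, 1; rewrite lamp1 conj1g mulg1. Qed.

Lemma tower_conj N a : tower N a -> tower N.+1 (a ^ x).
Proof. by move=> ta; exists 1, a; rewrite lamp1 mul1g. Qed.

Lemma tower_lamp N g : tower N.+1 (lamp g).
Proof. by exists g, 1; rewrite conj1g mulg1; split=> //; exact: tower1. Qed.

Lemma towerS N a : tower N a -> tower N.+1 a.
Proof.
elim: N a => [a ->|N IH a [g [f [tf ->]]]]; first exact: tower1.
by exists g, f; split=> //; exact: IH.
Qed.

Lemma tower_leq N M a : (N <= M)%N -> tower N a -> tower M a.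
Proof.
move=> /subnK <-; elim: (M - N)%N => [|k IH] // /IH; exact: towerS.
Qed.

Lemma tower_conjX N k a : tower N a -> tower (N + k) (a ^ (x ^+ k)).
Proof.
move=> ta; elim: k => [|k IH]; first by rewrite addn0 expg0 conjg1.
by rewrite addnS expgSr conjgM; exact: tower_conj.
Qed.

(** Cutting the product G_0 ... G_(1-m-k) after the first m factors. *)
Lemma tower_split m k a : tower (m + k) a ->
  exists a1 a2, [/\ tower m a1, tower k a2 & a = a1 * a2 ^ (x ^+ m)].
Proof.
elim: m a => [|m IH] a; first by exists 1, a; rewrite expg0 conjg1 mul1g.
case=> g [f [/IH[f1 [f2 [t1 t2 ->]]] ->]]; exists (lamp g * f1 ^ x), f2.
split=> //; first by exists g, f1.
by rewrite expgSr conjgM conjMg mulgA.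
Qed.

(** Dividing a by the lamp of the total product g of d makes the total product
trivial; conjugating by x then replaces the word by its prefix products, which
are trivial one letter earlier. *)
Lemma central_translation_tower N a d : wcentral d ->
  (forall w, act a w = wmul d w) -> fixes_from N a -> tower N a.
Proof.
elim: N a d => [|N IH] a d cd aE fa; first exact: fixes0.
have dN n : (N < n)%N -> d n = 1.
  by move=> Nn; have := fa wone n Nn; rewrite aE /wmul mulg1.
pose g := wprod d N; pose b := x * ((lamp g)^-1 * a) * x^-1.
have aB : a = lamp g * b ^ x by rewrite /b conjgE mulgVK mulKg mulKVg.
exists g, b; split=> //.
have bE w : act b w = wmul (fun n => g^-1 * wprod d n) w.
  rewrite /b !actM act_shiftV act_shift aE -lampV act_lamp.
  apply/funext; elim=> [|n IHn] /=.
    by rewrite /wmul /= mulgA.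
  rewrite IHn /wmul /= !mulgA -(mulgA _ (w n) (d n.+1)) -(cd n.+1 (w n)).
  by rewrite !mulgA mulgK.
have cg : central g by exact: wprod_central.
apply: IH (bE) _ => [n|w n Nn].
  by apply: centralM; [exact: centralV | exact: wprod_central].
rewrite bE /wmul; suff -> : wprod d n = g by rewrite mulVg mul1g.
move: Nn => /subnK <-; elim: (n - N)%N => //= k ->.
by rewrite dN ?mulg1 // ltnS leq_addl.
Qed.

(** Conjugation by l = x (lamp g) x^-1, which multiplies all letters by g,
preserves the tower: for affine f the commutator of l with f is a translation by
a central word, and it fixes the letters from N on because f does. *)
Lemma tower_norm_lamp N g f : (forall a b, tower N a -> tower N b ->
  tower N (a * b)) ->
  tower N f -> exists2 f', tower N f' & lamp g * f ^ x = f' ^ x * lamp g.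
Proof.
move=> tM tf; pose l := x * lamp g * x^-1.
have lE w : act l w = wmul (wconst g) w.
  rewrite /l 2!actM act_shiftV act_shift act_lamp.
  apply/funext; elim=> [|n IH] //=; rewrite IH /wmul /=.
  by case: (n) => //= *; rewrite -!mulgA mulKVg.
have lx : l ^ x = lamp g by rewrite conjg_unconj.
exists (l * f * l^-1); clearbody l; last first.
  by rewrite !conjMg conjVg lx mulgVK.
have -> : l * f * l^-1 = (l * f * l^-1 * f^-1) * f by rewrite mulgVK.
apply: tM => //.
have [_ fu] := tower_affine tf; have [z cz zE] := fu (wconst g).
apply: (@central_translation_tower _ _ (winv z)) => [n|w|].
- exact: centralV.
- rewrite !actM; set v := act l^-1 _.
  have vE : act f (act l v) = w by rewrite /v actKV actKV.
  by rewrite lE zE -lE in vE; rewrite -vE; apply/funext => n;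
    rewrite /wmul /winv mulKg.
- move=> w n Nn; rewrite !actM lE /wmul (tower_fixes tf) //.
  have := lE (act l^-1 (act f^-1 w)); rewrite actKV => /(congr1 (fun u => u n)).
  by rewrite /wmul => <-; exact: (fixesV (tower_fixes tf)).
Qed.

(** The tower of height N+1 is the product of G_0 and the conjugate by x^-1 of
the tower of height N, which G_0 normalizes. *)
Lemma towerM N a b : tower N a -> tower N b -> tower N (a * b).
Proof.
elim: N a b => [a b -> ->|N IH a b [g [f [tf ->]]] [g' [f' [tf' ->]]]];
  first by rewrite mulg1.
have [f1 tf1] := tower_norm_lamp g'^-1 IH tf.
rewrite lampV => f1E; exists (g * g'), (f1 * f'); split; first exact: IH.
have swap : f ^ x * lamp g' = lamp g' * f1 ^ x.
  by apply: (mulIg (lamp g')^-1); rewrite mulgK -mulgA -f1E mulKVg.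
by rewrite lampM conjMg -(mulgA (lamp g)) (mulgA (f ^ x)) swap -!mulgA.
Qed.

Lemma towerV N a : tower N a -> tower N a^-1.
Proof.
elim: N a => [a ->|N IH a [g [f [tf ->]]]]; first by rewrite invg1.
have [f' tf' f'E] := tower_norm_lamp g (@towerM N) tf.
exists g^-1, f'^-1; split; first exact: IH.
by rewrite f'E invgM conjVg lampV.
Qed.

(** In the abelian case finitary_part and expanding_part are the groups of lamp
configurations supported on two complementary half-lines. *)
Definition finitary_part : {pred Gam} := [pred a | `[<exists N, tower N a>]].
Definition expanding_part : {pred Gam} :=
  [pred a | `[<exists n, tower n (a ^ (x ^+ n))>]].

Lemma finitaryP a : reflect (exists N, tower N a) (a \in finitary_part).
Proof. exact: asboolP. Qed.

Lemma expandingP a :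
  reflect (exists n, tower n (a ^ (x ^+ n))) (a \in expanding_part).
Proof. exact: asboolP. Qed.

Lemma finitary_mul : mulg_closed finitary_part.
Proof.
move=> a b /finitaryP[N ta] /finitaryP[M tb]; apply/finitaryP; exists (N + M)%N.
by apply: towerM; [apply: tower_leq ta | apply: tower_leq tb]; lia.
Qed.

Lemma finitary_one : 1 \in finitary_part.
Proof. by apply/finitaryP; exists 0. Qed.

Lemma finitary_inv : invg_closed finitary_part.
Proof. by move=> a /finitaryP[N ta]; apply/finitaryP; exists N;
  exact: towerV. Qed.

HB.instance Definition _ := isMulClosed.Build Gam finitary_part finitary_mul.
HB.instance Definition _ := isMul1Closed.Build Gam finitary_part finitary_one.
HB.instance Definition _ := isInvClosed.Build Gam finitary_part finitary_inv.

Lemma expanding_add n m a : tower n (a ^ (x ^+ n)) ->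
  tower (n + m) (a ^ (x ^+ (n + m))).
Proof. by rewrite expgnDr conjgM; exact: tower_conjX. Qed.

Lemma expanding_mul : mulg_closed expanding_part.
Proof.
move=> a b /expandingP[n ta] /expandingP[m tb]; apply/expandingP;
  exists (n + m)%N.
rewrite conjMg; apply: towerM; first exact: expanding_add.
by rewrite addnC; exact: expanding_add.
Qed.

Lemma expanding_one : 1 \in expanding_part.
Proof. by apply/expandingP; exists 0; rewrite conj1g. Qed.

Lemma expanding_inv : invg_closed expanding_part.
Proof.
move=> a /expandingP[n ta]; apply/expandingP; exists n.
by rewrite conjVg; exact: towerV.
Qed.

HB.instance Definition _ := isMulClosed.Build Gam expanding_part expanding_mul.
HB.instance Definition _ := isMul1Closed.Build Gam expanding_part expanding_one.
HB.instance Definition _ := isInvClosed.Build Gam expanding_part expanding_inv.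

Lemma finitary_conjX k a : a \in finitary_part ->
  a ^ (x ^+ k) \in finitary_part.
Proof.
move=> /finitaryP[N ta]; apply/finitaryP; exists (N + k)%N; exact: tower_conjX.
Qed.

Lemma expanding_meet a : a \in expanding_part -> a \in finitary_part -> a = 1.
Proof.
move=> /expandingP[n /tower_fixes fx] /finitaryP[M /tower_fixes fa].
exact: fixes_meet fx fa.
Qed.

(** * The height homomorphism *)

(** Since x^-1 conjugates the finitary part into itself, the group is an
ascending extension of it, and each element has the form x^m b x^-n. *)
Definition has_height a (k : int) := exists m n b,
  [/\ b \in finitary_part, a = x ^+ m * b * x ^- n & k = (m%:Z - n%:Z)%R].

Lemma has_height_stable m n b i : x ^+ m * b * x ^- n =
  x ^+ (m + i) * b ^ (x ^+ i) * x ^- (n + i).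
Proof.
by rewrite expgnDr conjgE expgnDr invgM !mulgA mulgK mulgK.
Qed.

Lemma has_heightM a b (k l : int) : has_height a k -> has_height b l ->
  has_height (a * b) (k + l)%R.
Proof.
move=> [m [n [u [uB -> ->]]]] [m' [n' [v [vB -> ->]]]].
exists (m + m')%N, (n' + n)%N, (u ^ (x ^+ m') * v ^ (x ^+ n)); split.
- by rewrite gpredM ?finitary_conjX.
- rewrite (has_height_stable m n u m') (has_height_stable m' n' v n) (addnC m'
  n).
  by rewrite !mulgA mulgVK.
- lia.
Qed.

Lemma has_heightV a (k : int) : has_height a k -> has_height a^-1 (- k)%R.
Proof.
move=> [m [n [u [uB -> ->]]]]; exists n, m, u^-1; split.
- by rewrite gpredV.
- by rewrite !invgM invgK mulgA.
- lia.
Qed.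

Lemma has_height_finitary b : b \in finitary_part -> has_height b 0%R.
Proof. by move=> bB; exists 0, 0, b; rewrite expg0 invg1 mulg1 mul1g. Qed.

Lemma has_height_shift : has_height x 1%R.
Proof. by exists 1%N, 0, 1; split;
  rewrite ?finitary_one // expg0 expg1 invg1 !mulg1. Qed.

Lemma has_height_ex a : exists k : int, has_height a k.
Proof.
pose D : set Gam := [set a | exists k : int, has_height a k].
suff Da : D a by [].
apply: (cayley_group_ind (D := D)) => {a}[|a b [k ak] [l bl]|a [k ak]|g].
- by exists 0%R; exact/has_height_finitary/finitary_one.
- by exists (k + l)%R; exact: has_heightM.
- by exists (- k)%R; exact: has_heightV.
- exists (1 + 0)%R; apply: has_heightM has_height_shift _.
  by apply/has_height_finitary/finitaryP; exists 1%N; exact: tower_lamp.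
Qed.

Hypothesis nontrivial : exists g : gT, g != 1.

(** Applied to a word with last nontrivial letter at N, the map x^-k yields one
with last nontrivial letter at N + k. *)
Lemma shiftX_not_finitary k : x ^- k \in finitary_part -> k = 0%N.
Proof.
case: k => // k /finitaryP[N /tower_fixes fx]; have [g g1] := nontrivial.
pose w : word := fun n => if n == N then g else 1.
have wk j : act (x ^- j) w (N + j)%N != 1 /\
    forall n, (N + j < n)%N -> act (x ^- j) w n = 1.
  elim: j => [|j [wj w1]].
    rewrite expg0 invg1 act1 addn0 /w eqxx; split=> // n Nn.
    by rewrite gtn_eqF.
  rewrite expgSr invgM actM act_shiftV; split;
    first by rewrite addnS /= (w1 (N + j).+1) // mulg1 invg_eq1.
  case=> // n; rewrite addnS ltnS => Nn /=.
  by rewrite !w1 ?invg1 ?mulg1 // leqW.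
have [+ _] := wk k.+1; rewrite fx ?leq_addr //.
by rewrite /w -{2}[N]addn0 eqn_add2l /= eqxx.
Qed.

Lemma has_height1 (k : int) : has_height 1 k -> k = 0%R.
Proof.
move=> [m [n [b [bB mn ->]]]].
have bE : b = x ^- m * x ^+ n.
  by rewrite -[b in LHS](mulKg (x ^+ m)) -[x ^+ m * b](mulgVK (x ^+ n)) -mn
    mul1g.
case: (leqP m n) => [le_mn|/ltnW le_nm].
  have : x ^- (n - m) \in finitary_part.
    by rewrite -gpredV in bB; move: bB;
      rewrite bE -(subnKC le_mn) expgnDr mulKg addKn.
  by move/shiftX_not_finitary; lia.
have : x ^- (m - n) \in finitary_part.
  by move: bB; rewrite bE -{1}(subnKC le_nm) expgnDr invgM mulgVK.
by move/shiftX_not_finitary; lia.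
Qed.

Lemma has_height_unique a (k l : int) : has_height a k -> has_height a l ->
  k = l.
Proof.
move=> ak al; have := has_heightM (has_heightV ak) al.
by rewrite mulVg => /has_height1; lia.
Qed.

Lemma finitary_factor m b : b \in finitary_part ->
  exists a c, [/\ a \in expanding_part, c \in finitary_part
                & x ^+ m * b * x ^- m = a * c].
Proof.
move=> /finitaryP[N /(tower_leq (leq_addl m N))/tower_split[u [v [tu tv ->]]]].
exists (u ^ (x ^- m)), v; split.
- by apply/expandingP; exists m; rewrite -conjgM mulVg conjg1.
- by apply/finitaryP; exists N.
- by rewrite !conjgE invgK !mulgA mulgK.
Qed.

(** The last factor of the inverse of x^-(n+1) a x^(n+1), an element of the
tower of height n+1, supplies the lamp. *)
Lemma expanding_cover a : a \in expanding_part ->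
  exists g, (lamp g)^-1 * a ^ x \in expanding_part.
Proof.
move=> /expandingP[n] /(@expanding_add _ 1%N); rewrite addn1 expgS conjgM => ta.
have := towerV ta; rewrite -addn1 => /tower_split[u [v [tu [g [f [->
  ->]]] uv]]].
exists g^-1; apply/expandingP; exists n.
suff -> : ((lamp g^-1)^-1 * a ^ x) ^ (x ^+ n) = u^-1 by exact: towerV.
rewrite lampV invgK conjMg -[(a ^ x) ^ _]invgK uv invgM conj1g mulg1.
by rewrite mulKVg.
Qed.

Theorem cayley_automata_group_lamplighter :
  cross_wired_lamplighter (cayley_automata_group gT).
Proof.
have [h hP] := choice has_height_ex.
have hE a (k : int) : has_height a k ->
  h a = k by move=> /(has_height_unique (hP a)).
pose A : groupClosed Gam := expanding_part.
pose B : groupClosed Gam := finitary_part.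
have conjE k a : x ^- k * a * x ^+ k = a ^ (x ^+ k) by rewrite conjgE mulgA.
apply: (@lamplighter_criterion Gam A B h x #|gT| (fun i => lamp (enum_val i))).
- by move=> a b; apply/hE/has_heightM.
- exact/hE/has_height_shift.
- move=> a /expandingP[n tn]; apply: hE; exists n, n, (a ^ (x ^+ n)); split;
  last lia.
    by apply/finitaryP; exists n.
  by rewrite conjgE !mulgA mulgV mul1g mulgK.
- by move=> b bB; apply/hE/has_height_finitary.
- move=> a /expandingP[n tn]; apply/expandingP; exists n.+1.
  by rewrite expgS conjgM conjg_unconj; exact: towerS.
- by move=> b /(finitary_conjX 1); rewrite expg1 conjgE mulgA.
- move=> i; apply/expandingP; exists 1%N; rewrite expg1 conjg_unconj.
  exact: tower_lamp.
- by move=> i; apply/finitaryP; exists 1%N; exact: tower_lamp.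
- by move=> i j /lamp_inj/enum_val_inj.
- move=> a /expanding_cover[g ga]; exists (enum_rank g).
  by rewrite enum_rankK -mulgA -conjgE.
- move=> b /finitaryP[N /towerS[g [f [tf ->]]]]; exists (enum_rank g).
  rewrite enum_rankK mulKg conjgE mulKVg mulgK; apply/finitaryP; by exists N.
- exact: expanding_meet.
- move=> a a0; have [m [n [b [bB aE mn]]]] := hP a.
  have {mn}mn : m = n by move: mn; rewrite a0; lia.
  have [u [v [uA vB uv]]] := finitary_factor m bB.
  by exists u, v; split=> //; rewrite aE -mn.
- move=> b /finitaryP[N tb]; exists N; apply/expandingP; exists N.
  by rewrite conjg_unconj.
- move=> a /expandingP[n tn]; exists n; rewrite conjE; apply/finitaryP;
  by exists n.
- move=> D D1 DM DV Dl; apply: cayley_group_ind => // g.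
  by rewrite -(enum_rankK g); exact: Dl.
- have [g g1] := nontrivial.
  by apply/card_gt1P; exists g, 1.
Qed.

End Words.

(** * Groups of nilpotency class two *)

Local Close Scope quotient_scope.
Local Close Scope classical_set_scope.

Lemma class2_commutator_central (gT : finGroupType) :
  nilpotent [set: gT] -> nil_class [set: gT] = 2 ->
  forall a b : gT, central (a * b * a^-1 * b^-1).
Proof.
move=> nilG clG a b c.
have L3 : 'L_3([set: gT]) = 1 by apply/lcn_nil_classP; rewrite ?clG.
have : [~ [~ a^-1, b^-1], c] \in 'L_3([set: gT]).
  by rewrite !lcnSn; do 2?apply: mem_commg; rewrite ?lcn1 ?in_setT.
by rewrite L3 => /set1P/eqP/commgP; rewrite commgEl conjgE !invgK !mulgA.
Qed.

Lemma class2_nontrivial (gT : finGroupType) :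
  nil_class [set: gT] = 2 -> exists g : gT, g != 1.
Proof.
move=> clG; have /trivgPn[g _ g1] : [set: gT] :!=: 1 by rewrite -nil_class0 clG.
by exists g.
Qed.

Local Close Scope group_scope.

Theorem theorem1p2 (gT : finGroupType)
    (nilpotent_gT : nilpotent [set: gT])
    (class_gT : nil_class [set: gT] = 2) :
  cross_wired_lamplighter (cayley_automata_group gT).
Proof.
apply: cayley_automata_group_lamplighter.
  exact: class2_commutator_central.
exact: class2_nontrivial class_gT.
Qed.
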